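(* Let $(G,o)$ be a Menger algebra of rank $n$ and let $H$ be a nonempty $l$-strong subset of $G$. Then each $\mathcal{L}_H$-class $X$ with $X\neq {}_HW$ is $l$-strong, ${}_HW\subseteq {}_XW$, $\mathcal{L}_H\subseteq\mathcal{L}_X$, and the restrictions of $\mathcal{L}_H$ and $\mathcal{L}_X$ to $G\setminus {}_XW$ coincide, i.e. $\mathcal{L}_H\cap\big((G\setminus {}_XW)\times(G\setminus {}_XW)\big)=\mathcal{L}_X\cap\big((G\setminus {}_XW)\times(G\setminus {}_XW)\big)$.
   Context: Let $n$ be a positive integer. A Menger algebra $(G,o)$ of rank $n$ is a nonempty set $G$ with an $(n+1)$-ary operation $o:(f,g_1,\ldots,g_n)\mapsto f[g_1\ldots g_n]$ satisfying the superassociative law $f[g_1\ldots g_n][h_1\ldots h_n]=f[g_1[h_1\ldots h_n]\ldots g_n[h_1\ldots h_n]]$ for all $f,g_i,h_i\in G$. Put $B=G^n\cup\{\overline{e}\}$, where $\overline{e}=(e_1,\ldots,e_n)$ is a tuple of pairwise different formal symbols not in $G$. For $g\in G$ and $\overline{x}=(x_1,\ldots,x_n)\in G^n$ write $g[\overline{x}]=g[x_1\ldots x_n]$, and put $g[\overline{e}]=g$. For a subset $K\subseteq G$ and $g\in G$ put $\eta_K\langle g\rangle=\{\overline{x}\in B\mid g[\overline{x}]\in K\}$, ${}_KW=\{g\in G\mid\eta_K\langle g\rangle=\varnothing\}$, and $\mathcal{L}_K=\{(g_1,g_2)\in G\times G\mid\eta_K\langle g_1\rangle=\eta_K\langle g_2\rangle\}$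 (an equivalence relation). An $\mathcal{L}_K$-class is an equivalence class of $\mathcal{L}_K$. The subset $K$ is called $l$-strong if for all $a,b\in G$, $\eta_K\langle a\rangle\cap\eta_K\langle b\rangle\neq\varnothing$ implies $\eta_K\langle a\rangle=\eta_K\langle b\rangle$. *)

(* Defs.v *)
From mathcomp Require Import all_boot boolp classical_sets.

Set Implicit Arguments.
Unset Strict Implicit.
Unset Printing Implicit Defensive.

Local Open Scope classical_set_scope.

(* The positivity of the rank n is not part of the structure: it is a
   hypothesis wherever it is required. *)
Record mengerAlgebra (n : nat) := MengerAlgebra {
  carrier :> Type;
  mop : carrier -> n.-tuple carrier -> carrier;
  mop_superassoc : forall (f : carrier) (g h : n.-tuple carrier),
    mop (mop f g) h = mop f [tuple mop (tnth g i) h | i < n];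
  carrier_nonempty : inhabited carrier
}.

Section Menger.
Variables (n : nat) (G : mengerAlgebra n).

(* B = G^n together with the formal tuple of selectors: [Some x] is a tuple
   x of G^n, and [None] is the extra element (e_1, ..., e_n). *)
Definition mengerB := option (n.-tuple G).

Definition act (g : G) (x : mengerB) : G :=
  if x is Some t then mop g t else g.

Definition eta (K : set G) (g : G) : set mengerB := [set x | K (act g x)].

Definition W (K : set G) : set G := [set g | eta K g = set0].

Definition Lrel (K : set G) : set (G * G) :=
  [set p | eta K p.1 = eta K p.2].

Definition Lclass (K : set G) (X : set G) : Prop :=
  exists g : G, X = [set x | Lrel K (g, x)].

Definition l_strong (K : set G) : Prop :=
  forall a b : G, eta K a `&` eta K b <> set0 -> eta K a = eta K b.

End Menger.

(* Main.v *)
Require Import Defs.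
From mathcomp Require Import all_boot boolp classical_sets.

Local Open Scope classical_set_scope.

(* B is a monoid acting on G on the right, so L_H is compatible with this
   action, which gives the inclusion of L_H in L_X. If the elements a x and b x
   both lie in X, pick y with g x y in H for a representative g of X: then x y
   lies in both eta_H a and eta_H b, and l-strongness of H forces a L_H b. *)

Definition mulB {n : nat} {G : mengerAlgebra n} (x y : mengerB G) : mengerB G :=
  if x is Some s then
    if y is Some t then Some [tuple mop (tnth s i) t | i < n] else x
  else y.

Lemma act_mulB {n : nat} {G : mengerAlgebra n} (g : G) (x y : mengerB G) :
  act g (mulB x y) = act (act g x) y.
Proof. by case: x y => [s|] [t|] //=; rewrite mop_superassoc. Qed.

Lemma eta_act {n : nat} {G : mengerAlgebra n} (K : set G) (g : G)
    (x y : mengerB G) : eta K (act g x) y = eta K g (mulB x y).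
Proof. by rewrite /eta /mkset act_mulB. Qed.

Lemma eta_act_congr {n : nat} {G : mengerAlgebra n} (K : set G) (a b : G)
    (x : mengerB G) : eta K a = eta K b -> eta K (act a x) = eta K (act b x).
Proof. by move=> ab; apply/funext => y; rewrite !eta_act ab. Qed.

(** All members of a class share one set [eta K g]. If it is empty, the class is [W K] itself;
    otherwise any of its points serves as [y]. *)
Lemma Lclass_witness {n : nat} {G : mengerAlgebra n} (K X : set G) :
  Lclass K X -> X <> W K -> exists y, forall g, X g -> eta K g y.
Proof.
move=> [g ->] nW; have [g0|/eqP/set0P[y gy]] := pselect (eta K g = set0).
  by case: nW; apply/seteqP; split=> h; rewrite /W /Lrel /mkset /= g0.
by exists y => h; rewrite /Lrel /mkset /= => <-.
Qed.

(** Related [a] and [b] stay related after acting by any [x], so [act a x] and [act b x] lie in the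
    same class. *)
Lemma Lclass_Lrel_sub {n : nat} {G : mengerAlgebra n} (K X : set G) :
  Lclass K X -> Lrel K `<=` Lrel X.
Proof.
move=> [g ->] [a b] /= ab; apply/funext => x.
by rewrite /eta /Lrel /mkset /= (eta_act_congr _ _ _ x ab).
Qed.

Lemma Lclass_common_Lrel {n : nat} {G : mengerAlgebra n} (K X : set G)
    (a b : G) (x : mengerB G) :
  l_strong K -> Lclass K X -> X <> W K -> eta X a x -> eta X b x ->
  Lrel K (a, b).
Proof.
move=> Ks XK nW ax bx; have [y Xy] := Lclass_witness _ _ XK nW.
by apply: Ks; apply/eqP/set0P; exists (mulB x y); split;
  rewrite -eta_act; apply: Xy.
Qed.

Theorem theorem3p8 (n : nat) (hn : 0 < n) (G : mengerAlgebra n) (H : set G)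
    (H_nonempty : H <> set0) (H_strong : l_strong H)
    (X : set G) (X_class : Lclass H X) (X_neq_W : X <> W H) :
  [/\ l_strong X,
      W H `<=` W X,
      Lrel H `<=` Lrel X &
      Lrel H `&` (~` W X `*` ~` W X) = Lrel X `&` (~` W X `*` ~` W X)].
Proof.
have LHX := Lclass_Lrel_sub _ _ X_class.
split=> //.
- move=> a b /eqP/set0P[x [ax bx]].
  exact: (LHX (a, b) (Lclass_common_Lrel _ _ _ _ x _ _ _ ax bx)).
- have [y Xy] := Lclass_witness _ _ X_class X_neq_W.
  (* A point [x] of [eta X a] would put [mulB x y] into the empty set [eta H a]. *)
  move=> a a0; rewrite /W /= -subset0 => x /Xy.
  by rewrite eta_act a0.
- apply/seteqP; split=> -[a b] [ab [/= aW bW]]; split=> //; first exact: LHX.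
  (* Outside [W X] the set [eta X a] has a point [x], and [ab] makes it a point of [eta X b] too. *)
  have /eqP/set0P[x ax] := aW.
  by apply: (Lclass_common_Lrel _ _ _ _ x _ _ _ ax) => //; rewrite -ab.
Qed.
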